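(* Let $K \in \mathbb{R}^{n\times n}$ be a rate constant matrix with stationary distribution $\pi \in \Delta_n^\circ$ and let $\{S,T\}$ be a bipartition of $[n]$ with $K_{SS}$ nonsingular. Let $W := \{y \in \mathbb{R}^n : K_{SS}y_S + K_{ST}y_T = \mathbf{0}\}$. A matrix $V \in \mathbb{R}^{n\times n}$ satisfies both (i) $V$ is self-adjoint with respect to the $\pi$-inner product, and (ii) $\operatorname{Im} V \subseteq W$, if and only if $V$ is of the form (with blocks ordered $S, T$) $$V = \begin{pmatrix} K_{SS}^{-1} K_{ST} V_{TT} K_{TS} K_{SS}^{-1} & -K_{SS}^{-1} K_{ST} V_{TT} \\ -V_{TT} K_{TS} K_{SS}^{-1} & V_{TT} \end{pmatrix}$$ with a self-adjoint matrix $V_{TT} \in \mathbb{R}^{T\times T}$.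
   Context: $[n] = \{1,\dotsc,n\}$. $\Delta_n^\circ = \{y \in \mathbb{R}_{>0}^n : \sum_i y_i = 1\}$. A rate constant matrix with stationary distribution $\pi \in \Delta_n^\circ$ is a matrix $K \in \mathbb{R}^{n\times n}$ such that $K_{ij} \ge 0$ for $i \ne j$, every column of $K$ sums to $0$, and $K_{ij}\pi_j = K_{ji}\pi_i$ for all $i,j$. For $I \subseteq [n]$, $\Pi_I = \mathrm{diag}(\pi_I)$, and $\mathbb{R}^I$ carries the $\pi$-inner product $\langle a,b\rangle_\pi = a^\top \Pi_I^{-1} b$. A matrix $A \in \mathbb{R}^{I\times I}$ is self-adjoint if $A = \Pi_I A^\top \Pi_I^{-1}$. A bipartition $\{S,T\}$ of $[n]$ is a pair of disjoint nonempty sets with $S \cup T = [n]$; $A_{IJ}$ denotes the submatrix of $A$ with rows $I$ and columns $J$, $y_I$ the subvector of $y$ indexed by $I$, and $K_{SS}^{-1} = (K_{SS})^{-1}$. *)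

(* Defs.v *)
From mathcomp Require Import all_boot all_order all_algebra.
From mathcomp Require Import classical_sets reals.

Set Implicit Arguments.
Unset Strict Implicit.
Unset Printing Implicit Defensive.

Import GRing.Theory Num.Theory.

Local Open Scope ring_scope.

Definition open_simplex (R : realType) (n : nat) (y : 'cV[R]_n) : Prop :=
  (forall i, 0 < y i 0) /\ \sum_i y i 0 = 1.

Definition rate_constant_matrix (R : realType) (n : nat)
    (K : 'M[R]_n) (pi : 'cV[R]_n) : Prop :=
  [/\ open_simplex pi,
      forall i j, i != j -> 0 <= K i j,
      forall j, \sum_i K i j = 0
    & forall i j, K i j * pi j 0 = K j i * pi i 0].

(* [finset.set0] is the empty [{set _}]; the short name is that of
   [classical_sets]. *)
Definition bipartition (n : nat) (S T : {set 'I_n}) : Prop :=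
  [/\ S != finset.set0, T != finset.set0, [disjoint S & T]
    & S :|: T = [set: 'I_n]%SET].

(* R^I and R^(I x J) are encoded as 'cV_#|I| and 'M_(#|I|, #|J|), the elements
   of I and J being listed in increasing order by [enum_val]. *)
Definition subvec (R : realType) (n : nat) (I : {set 'I_n}) (y : 'cV[R]_n)
    : 'cV[R]_#|I| :=
  rowsub (fun i : 'I_#|I| => enum_val i) y.

Definition subblock (R : realType) (n : nat) (I J : {set 'I_n}) (A : 'M[R]_n)
    : 'M[R]_(#|I|, #|J|) :=
  mxsub (fun i : 'I_#|I| => enum_val i) (fun j : 'I_#|J| => enum_val j) A.

(* A is self-adjoint for <a, b> = a^T diag(p)^-1 b. *)
Definition self_adjoint (R : realType) (m : nat) (p : 'cV[R]_m) (A : 'M[R]_m)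
    : Prop :=
  A = diag_mx p^T *m A^T *m invmx (diag_mx p^T).

(* Lists the elements of S, then those of T. *)
Definition block_index (n : nat) (S T : {set 'I_n}) (k : 'I_(#|S| + #|T|))
    : 'I_n :=
  match split k with
  | inl s => enum_val s
  | inr t => enum_val t
  end.

(* The matrix A with its rows and columns reordered so that those indexed by S
   come first; for a bipartition {S, T} it determines A. *)
Definition block_order (R : realType) (n : nat) (S T : {set 'I_n})
    (A : 'M[R]_n) : 'M[R]_(#|S| + #|T|) :=
  mxsub (@block_index n S T) (@block_index n S T) A.

Definition steady_space (R : realType) (n : nat) (K : 'M[R]_n)
    (S T : {set 'I_n}) : set 'cV[R]_n :=
  [set y | subblock S S K *m subvec S y + subblock S T K *m subvec T y = 0]%classic.

Definition mx_image (R : realType) (m n : nat) (A : 'M[R]_(m, n))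
    : set 'cV[R]_m :=
  range (fun x : 'cV[R]_n => A *m x).

(* Main.v *)
(* The inclusion [Im V <= W] says [K_SS V_SJ + K_ST V_TJ = 0] for [J = S, T], so
   it determines the S-rows of V from its T-rows.  Self-adjointness says that
   the pi-adjoint of each block [V_IJ] is [V_JI]; since K is self-adjoint too
   (detailed balance), taking the adjoint of [V_ST = - K_SS^-1 K_ST V_TT] gives
   [V_TS = - V_TT K_TS K_SS^-1], and everything is expressed through [V_TT]. *)

Require Import Defs.
From mathcomp Require Import all_boot all_order all_algebra.
From mathcomp Require Import classical_sets reals.

Set Implicit Arguments.
Unset Strict Implicit.
Unset Printing Implicit Defensive.

Import Order.TTheory GRing.Theory Num.Theory.

Local Open Scope ring_scope.

(* [B] is the adjoint of [A : R^k -> R^m] for the inner products weighted by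
   the inverses of [q] and [p]; the inverses are cleared. *)
Definition adjoint_pair (R : pzRingType) (m k : nat) (p : 'cV[R]_m) (q : 'cV[R]_k)
    (A : 'M[R]_(m, k)) (B : 'M[R]_(k, m)) : Prop :=
  A *m diag_mx q^T = diag_mx p^T *m B^T.

(** For [A = B = K] and [p = q = pi], the entrywise form is exactly detailed balance. *)
Lemma adjoint_pairP (R : comPzRingType) (m k : nat) (p : 'cV[R]_m) (q : 'cV[R]_k)
    (A : 'M[R]_(m, k)) (B : 'M[R]_(k, m)) :
  adjoint_pair p q A B <-> forall i j, A i j * q j 0 = B j i * p i 0.
Proof.
rewrite /adjoint_pair mul_mx_diag mul_diag_mx; split=> [/matrixP AB i j|AB].
  by have := AB i j; rewrite !mxE [p i 0 * _]mulrC.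
by apply/matrixP => i j; rewrite !mxE AB mulrC.
Qed.

Lemma adjoint_pair_sym (R : comPzRingType) (m k : nat) (p : 'cV[R]_m)
    (q : 'cV[R]_k) (A : 'M[R]_(m, k)) (B : 'M[R]_(k, m)) :
  adjoint_pair p q A B -> adjoint_pair q p B A.
Proof. by move=> /adjoint_pairP AB; apply/adjoint_pairP => i j; rewrite AB. Qed.

Lemma adjoint_pair_mul (R : comPzRingType) (m k l : nat) (p : 'cV[R]_m)
    (q : 'cV[R]_k) (r : 'cV[R]_l) (A : 'M[R]_(m, k)) A' (B : 'M[R]_(k, l)) B' :
  adjoint_pair p q A A' -> adjoint_pair q r B B' ->
  adjoint_pair p r (A *m B) (B' *m A').
Proof.
rewrite /adjoint_pair => AA' BB'.
by rewrite -mulmxA BB' mulmxA AA' -mulmxA trmx_mul.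
Qed.

Lemma adjoint_pair_opp (R : comPzRingType) (m k : nat) (p : 'cV[R]_m)
    (q : 'cV[R]_k) (A : 'M[R]_(m, k)) (B : 'M[R]_(k, m)) :
  adjoint_pair p q A B -> adjoint_pair p q (- A) (- B).
Proof.
by move=> /adjoint_pairP AB; apply/adjoint_pairP => i j; rewrite !mxE !mulNr AB.
Qed.

(** With [D = diag_mx p^T], multiplying [A D = D B^T] by [A^-1] on the left and [B^-T] on the right
    gives [D B^-T = A^-1 D]. *)
Lemma adjoint_pair_inv (R : comUnitRingType) (m : nat) (p : 'cV[R]_m)
    (A B : 'M[R]_m) :
  A \in unitmx -> B \in unitmx ->
  adjoint_pair p p A B -> adjoint_pair p p (invmx A) (invmx B).
Proof.
rewrite /adjoint_pair => uA uB AB.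
have uBT : B^T \in unitmx by rewrite unitmx_tr.
apply: (can_inj (mulKmx uA)); apply: (can_inj (mulmxK uBT)).
by rewrite mulKVmx // mulmxA AB -!mulmxA trmx_inv mulVmx // mulmx1.
Qed.

(** Cancelling [q j 0] recovers each entry of the first matrix from [B]; this is how [V_TS] is read
    off from [V_ST]. *)
Lemma adjoint_pair_uniq (R : idomainType) (m k : nat) (p : 'cV[R]_m)
    (q : 'cV[R]_k) (A A' : 'M[R]_(m, k)) (B : 'M[R]_(k, m)) :
  (forall j, q j 0 != 0) ->
  adjoint_pair p q A B -> adjoint_pair p q A' B -> A = A'.
Proof.
move=> q0 /adjoint_pairP AB /adjoint_pairP A'B; apply/matrixP => i j.
by apply: (mulIf (q0 j)); rewrite AB A'B.
Qed.

Lemma self_adjointP (R : realType) (m : nat) (p : 'cV[R]_m) (A : 'M[R]_m) :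
  (forall i, p i 0 != 0) -> self_adjoint p A <-> adjoint_pair p p A A.
Proof.
move=> p0; rewrite /self_adjoint /adjoint_pair.
have uD : diag_mx p^T \in unitmx.
  rewrite unitmxE det_diag unitfE; apply/prodf_neq0 => i _.
  by rewrite mxE p0.
by split=> [{1}->|<-]; rewrite ?mulmxKV ?mulmxK.
Qed.

Lemma adjoint_pair_subblock (R : realType) (n : nat) (p : 'cV[R]_n)
    (A B : 'M[R]_n) (I J : {set 'I_n}) :
  adjoint_pair p p A B ->
  adjoint_pair (subvec I p) (subvec J p) (subblock I J A) (subblock J I B).
Proof. by move=> /adjoint_pairP AB; apply/adjoint_pairP => i j; rewrite !mxE AB. Qed.

Lemma block_order_mx (R : realType) (n : nat) (S T : {set 'I_n}) (A : 'M[R]_n) :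
  block_order S T A =
    block_mx (subblock S S A) (subblock S T A) (subblock T S A) (subblock T T A).
Proof.
apply/matrixP => i j; rewrite !mxE /block_index.
by case: (split i) => a; rewrite !mxE; case: (split j) => b; rewrite !mxE.
Qed.

Lemma setU_enum_val (n : nat) (S T : {set 'I_n}) (i : 'I_n) :
  S :|: T = [set: 'I_n]%SET ->
  (exists s : 'I_#|S|, enum_val s = i) \/ (exists t : 'I_#|T|, enum_val t = i).
Proof.
move=> ST; have: i \in S :|: T by rewrite ST finset.in_setT.
by rewrite finset.in_setU => /orP[] iI; [left|right]; exists (enum_rank_in iI i);
  rewrite enum_rankK_in.
Qed.

(** Converse of [adjoint_pair_subblock]: each entry lies in one of the four blocks, as S and T cover
    the indices. *)
Lemma adjoint_pair_blocks (R : realType) (n : nat) (p : 'cV[R]_n)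
    (A B : 'M[R]_n) (S T : {set 'I_n}) :
  S :|: T = [set: 'I_n]%SET ->
  adjoint_pair (subvec S p) (subvec S p) (subblock S S A) (subblock S S B) ->
  adjoint_pair (subvec S p) (subvec T p) (subblock S T A) (subblock T S B) ->
  adjoint_pair (subvec T p) (subvec S p) (subblock T S A) (subblock S T B) ->
  adjoint_pair (subvec T p) (subvec T p) (subblock T T A) (subblock T T B) ->
  adjoint_pair p p A B.
Proof.
move=> ST /adjoint_pairP SS /adjoint_pairP ST' /adjoint_pairP TS /adjoint_pairP TT.
apply/adjoint_pairP => i j.
by case: (setU_enum_val i ST) => -[a <-]; case: (setU_enum_val j ST) => -[b <-];
  [have := SS a b | have := ST' a b | have := TS a b | have := TT a b];
  rewrite !mxE.
Qed.

(** Both sides say that the matrix [M] of the map [x |-> K_SS (V x)_S + K_ST (V x)_T] vanishes; the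
    right side splits its columns into those in S and those in T. *)
Lemma image_sub_steady_space (R : realType) (n : nat) (K V : 'M[R]_n)
    (S T : {set 'I_n}) :
  S :|: T = [set: 'I_n]%SET ->
  (mx_image V `<=` steady_space K S T)%classic <->
  subblock S S K *m subblock S S V + subblock S T K *m subblock T S V = 0 /\
  subblock S S K *m subblock S T V + subblock S T K *m subblock T T V = 0.
Proof.
move=> ST.
pose M := subblock S S K *m rowsub (fun i : 'I_#|S| => enum_val i) V +
          subblock S T K *m rowsub (fun i : 'I_#|T| => enum_val i) V.
have ME (J : {set 'I_n}) : subblock S S K *m subblock S J V +
    subblock S T K *m subblock T J V = colsub (fun j : 'I_#|J| => enum_val j) M.
  by apply/matrixP => i j; rewrite !mxE; congr (_ + _);
    apply: eq_bigr => k _; rewrite !mxE.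
have WE x : steady_space K S T (V *m x) <-> M *m x = 0.
  by rewrite /steady_space /subvec /= -!mul_rowsub_mx !mulmxA -mulmxDl.
rewrite !ME; split=> [sub|[MS MT]].
  suff -> : M = 0 by split; apply/matrixP => i j; rewrite !mxE.
  apply/matrixP => i j.
  (* Testing on the j-th basis vector isolates column j of [M]. *)
  have /WE/matrixP/(_ i 0) := sub _ (ex_intro2 _ _ (delta_mx j 0) I erefl).
  by rewrite -colE !mxE.
have M0 : M = 0.
  apply/matrixP => i j; case: (setU_enum_val j ST) => -[a <-].
    by have /matrixP/(_ i a) := MS; rewrite !mxE.
  by have /matrixP/(_ i a) := MT; rewrite !mxE.
by move=> _ [x _ <-]; apply/WE; rewrite M0 mul0mx.
Qed.

Lemma mul_add_eq0 (R : comUnitRingType) (m k l : nat) (A : 'M[R]_m)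
    (B : 'M[R]_(m, k)) (X : 'M[R]_(m, l)) (Y : 'M[R]_(k, l)) :
  A \in unitmx -> A *m X + B *m Y = 0 <-> X = - (invmx A *m B *m Y).
Proof.
move=> uA; split=> [/eqP|->].
  by rewrite addr_eq0 => /eqP AX; rewrite -mulmxA -mulmxN -AX mulKmx.
by rewrite mulmxN -mulmxA mulKVmx // addNr.
Qed.

Theorem proposition3p1 (R : realType) (n : nat) (K : 'M[R]_n) (pi : 'cV[R]_n)
    (S T : {set 'I_n})
    (hK : rate_constant_matrix K pi)
    (hST : bipartition S T)
    (hS : subblock S S K \in unitmx)
    (V : 'M[R]_n) :
  (self_adjoint pi V /\ (mx_image V `<=` steady_space K S T)%classic)
  <->
  exists VTT : 'M[R]_#|T|,
    self_adjoint (subvec T pi) VTT /\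
    block_order S T V =
      block_mx
        (invmx (subblock S S K) *m subblock S T K *m VTT *m subblock T S K
           *m invmx (subblock S S K))
        (- (invmx (subblock S S K) *m subblock S T K *m VTT))
        (- (VTT *m subblock T S K *m invmx (subblock S S K)))
        VTT.
Proof.
case: hK => -[pi_gt0 _] _ _ /adjoint_pairP hKpi; case: hST => _ _ _ ST.
have pi0 i : pi i 0 != 0 by rewrite gt_eqF.
have piI0 (I : {set 'I_n}) i : subvec I pi i 0 != 0 by rewrite mxE.
have KI I J := adjoint_pair_subblock I J hKpi.
have KSSV := adjoint_pair_inv hS hS (KI S S).
(* The adjoint of [- K_SS^-1 K_ST X] is [- X K_TS K_SS^-1]. *)
have adjTS X : adjoint_pair (subvec T pi) (subvec T pi) X X ->
    adjoint_pair (subvec T pi) (subvec S pi)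
      (- (X *m subblock T S K *m invmx (subblock S S K)))
      (- (invmx (subblock S S K) *m subblock S T K *m X)).
  move=> XX; apply: adjoint_pair_opp; rewrite -[_ *m _ *m X]mulmxA.
  exact: adjoint_pair_mul (adjoint_pair_mul XX (KI T S)) KSSV.
(* The inclusion becomes [V_SS = - K_SS^-1 K_ST V_TS] and [V_ST = - K_SS^-1 K_ST V_TT]. *)
rewrite image_sub_steady_space // !mul_add_eq0 // self_adjointP // block_order_mx.
split=> [[VV [VSS VST]]|[X [/self_adjointP XX /eq_block_mx[VSS VST VTS VTT]]]].
  have VTT := adjoint_pair_subblock T T VV.
  exists (subblock T T V); split; first exact/self_adjointP.
  have VTS : subblock T S V =
      - (subblock T T V *m subblock T S K *m invmx (subblock S S K)).
    (* Both sides have [V_ST] as their adjoint. *)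
    apply: adjoint_pair_uniq (adjoint_pair_subblock T S VV) _ => //.
    by rewrite VST; apply: adjTS.
  (* Substituting [V_TS] into [V_SS] cancels the two signs. *)
  by rewrite VSS VTS VST mulmxN opprK !mulmxA.
have {}XX := XX (piI0 T).
split; last by rewrite VSS VST VTS VTT mulmxN opprK !mulmxA.
apply: (adjoint_pair_blocks ST); rewrite ?VSS ?VST ?VTS ?VTT //.
(* The SS block is [(K_SS^-1 K_ST) X (K_TS K_SS^-1)]. Its outer factors are adjoint to each other
   and [X] is self-adjoint, so reversing the product returns the same block. *)
- have := adjoint_pair_mul (adjoint_pair_mul KSSV (KI S T))
    (adjoint_pair_mul XX (adjoint_pair_mul (KI T S) KSSV)).
  by rewrite !mulmxA.
- exact/adjoint_pair_sym/adjTS.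
- exact: adjTS.
Qed.
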